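(* Let $G$ be a graph constructed, together with a coloring of its vertices, by the following procedure: (1) Construct an odd cycle and color its vertices blue. (2) Either perform step (3), or perform step (4), or stop. (3) Choose any existing vertex $u$, add two new vertices $u_1,u_2$ and edges $uu_1, u_1u_2$; color $u_1$ red and $u_2$ black; go to (2). (4) If there is no red vertex go to (2); otherwise choose a red vertex $u$, add a new vertex $u_1$ and the edge $uu_1$, color $u_1$ black; go to (2). Then there exists a maximum independent set of $G$ that contains all the black vertices of $G$.
   Context: All graphs are finite and simple. A maximum independent set is an independent set of largest possible size. *)

(* Defs.v *)
From mathcomp Require Import all_boot.

Set Implicit Arguments.
Unset Strict Implicit.
Unset Printing Implicit Defensive.

Inductive color := Blue | Red | Black.

Record cgraph := CGraph {
  vertex :> finType;
  edge : rel vertex;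
  edge_sym : symmetric edge;
  edge_irrefl : irreflexive edge;
  colour : vertex -> color
}.

Definition cycle_edge (n : nat) : rel 'I_n :=
  fun i j => (j == ordS i) || (i == ordS j).

Lemma cycle_edge_sym n : symmetric (@cycle_edge n).
Proof. by move=> i j; rewrite /cycle_edge orbC. Qed.

Lemma cycle_edge_irrefl n : 2 < n -> irreflexive (@cycle_edge n).
Proof.
move=> n_gt2 i; rewrite /cycle_edge orbb; apply/negbTE/eqP => /(congr1 val) /=.
have := ltn_ord i; rewrite leq_eqVlt => /orP[/eqP iE|lt_in].
  by rewrite iE modnn => i0; move: n_gt2; rewrite -iE i0.
by rewrite modn_small // => /eqP; rewrite -{1}[nat_of_ord i]addn0 -addn1 eqn_add2l.
Qed.

Definition blue_cycle (n : nat) (n_gt2 : 2 < n) : cgraph :=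
  CGraph (@cycle_edge_sym n) (cycle_edge_irrefl n_gt2) (fun _ => Blue).

(* The vertex set becomes [option G]: [None] is the new vertex and [Some x]   *)
(* is the old vertex [x].                                                     *)
Definition pendant_edge (G : cgraph) (u : G) : rel (option G) :=
  fun x y => match x, y with
             | Some a, Some b => edge a b
             | Some a, None => a == u
             | None, Some b => b == u
             | None, None => false
             end.

Lemma pendant_edge_sym (G : cgraph) (u : G) : symmetric (pendant_edge u).
Proof. by move=> [a|] [b|] //=; apply: edge_sym. Qed.

Lemma pendant_edge_irrefl (G : cgraph) (u : G) : irreflexive (pendant_edge u).
Proof. by move=> [a|] //=; apply: edge_irrefl. Qed.

Definition add_pendant (G : cgraph) (u : G) (c : color) : cgraph :=
  CGraph (pendant_edge_sym u) (pendant_edge_irrefl u)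
    (fun x => if x is Some a then colour a else c).

Definition cgraph_iso (G H : cgraph) : Prop :=
  exists f : G -> H,
    [/\ bijective f,
        forall x y, edge (f x) (f y) = edge x y
      & forall x, colour (f x) = colour x].

(* [constructed_iso] makes the identity of the vertices irrelevant: the other *)
(* constructors only produce graphs on iterated [option]s of an ordinal type. *)
Inductive constructed : cgraph -> Prop :=
| constructed_cycle (n : nat) (n_gt2 : 2 < n) :
    odd n -> constructed (blue_cycle n_gt2)
| constructed_path (G : cgraph) (u : G) :
    constructed G ->
    constructed (@add_pendant (add_pendant u Red) None Black)
| constructed_leaf (G : cgraph) (u : G) :
    constructed G -> colour u = Red -> constructed (add_pendant u Black)
| constructed_iso (G H : cgraph) :
    constructed G -> cgraph_iso G H -> constructed H.

Definition independent (G : cgraph) (S : {set G}) : Prop :=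
  forall x y, x \in S -> y \in S -> ~~ edge x y.

Definition maximum_independent (G : cgraph) (S : {set G}) : Prop :=
  independent S /\ forall S' : {set G}, independent S' -> #|S'| <= #|S|.

(* Main.v *)
Require Import Defs.
From mathcomp Require Import all_boot.

Set Implicit Arguments.
Unset Strict Implicit.
Unset Printing Implicit Defensive.

(** Induct on the construction, strengthening the claim to: some maximum
    independent set contains every black vertex and no red vertex.  On the bare
    cycle any maximum independent set will do.  Each step raises the
    independence number by at most one: in step (3) the two new vertices are
    adjacent, in step (4) there is only one.  Adding the new black vertex to the
    old set keeps it independent, since its only neighbour is red and hence
    outside the set. *)

Lemma independent0 (G : cgraph) : independent (set0 : {set G}).
Proof. by move=> x y; rewrite inE. Qed.

(** A boolean form of independence, so that a largest set can be selected among the finitely many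
    subsets. *)
Lemma independentP (G : cgraph) (S : {set G}) :
  reflect (independent S) [forall x in S, forall y in S, ~~ edge x y].
Proof.
apply: (iffP forall_inP) => [indS x y xS yS | indS x xS].
  by have /forall_inP := indS x xS; apply.
by apply/forall_inP => y; apply: indS.
Qed.

Lemma maximum_independent_exists (G : cgraph) :
  exists S : {set G}, maximum_independent S.
Proof.
have /independentP ind0 := @independent0 G.
case: (arg_maxnP (P := fun S : {set G} => [forall x in S, forall y in S, ~~ edge x y])
                 (fun S => #|S|) ind0) => S /independentP indS maxS.
by exists S; split=> // S' /independentP; apply: maxS.
Qed.

Lemma card_option_set (T : finType) (S : {set option T}) :
  #|S| = (None \in S) + #|[set x | Some x \in S]|.
Proof.
rewrite (cardsD1 None) -(card_imset (mem [set x | Some x \in S]) (@Some_inj _)); congr (_ + #|pred_of_set _|).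
apply/setP => -[x|]; rewrite !inE /=.
  by rewrite mem_imset ?inE //; apply: Some_inj.
by apply/esym/negbTE/imsetP => -[].
Qed.

(** The flag [b] decides whether the new vertex joins the set. *)
Definition lift_set (T : finType) (b : bool) (S : {set T}) : {set option T} :=
  [set x | if x is Some a then a \in S else b].

Lemma card_lift_set (T : finType) b (S : {set T}) : #|lift_set b S| = b + #|S|.
Proof.
rewrite card_option_set inE; congr (_ + #|pred_of_set _|).
by apply/setP => x; rewrite !inE.
Qed.

Lemma independent_restrict (G : cgraph) (u : G) (c : color)
    (S : {set add_pendant u c}) :
  independent S -> independent [set x : G | Some x \in S].
Proof. by move=> indS x y; rewrite !inE; apply: indS. Qed.

(** The only neighbour of the new vertex is [u], so a conflict can arise only when [b] holds and [u]
    is in [S]. *)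
Lemma independent_lift (G : cgraph) (u : G) (c : color) (b : bool) (S : {set G}) :
  (b -> u \notin S) -> independent S ->
  independent (lift_set b S : {set add_pendant u c}).
Proof.
move=> uS indS [x|] [y|]; rewrite !inE //=; first exact: indS.
- by move=> xS /uS; apply: contraNN => /eqP <-.
- by move=> /uS uNS yS; apply: contraNN uNS => /eqP <-.
Qed.

Definition black_not_red_maximum (G : cgraph) (S : {set G}) : Prop :=
  [/\ maximum_independent S,
      forall v : G, colour v = Black -> v \in S
    & forall v : G, colour v = Red -> v \notin S].

Lemma black_not_red_path (G : cgraph) (u : G) (S : {set G}) :
  black_not_red_maximum S ->
  black_not_red_maximum (lift_set true (lift_set false S)
    : {set @add_pendant (add_pendant u Red) None Black}).
Proof.
move=> [[indS maxS] blackS redS]; split.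
(* The black vertex hangs on the red one, which the inner lift leaves out. *)
- split; first by do 2?[apply: independent_lift]; rewrite ?inE.
  move=> S' indS'; rewrite !card_lift_set card_option_set.
  (* Split [S'] into its part on the two new vertices, of size at most one, and its old part, of
     size at most [#|S|]. *)
  rewrite (card_option_set [set x | Some x \in S']) addnA leq_add //; last first.
    by apply: maxS; do 2!apply: independent_restrict.
  (* [None] is the black vertex and [Some None] the red one; they are adjacent. *)
  rewrite inE; have := indS' None (Some None).
  by case: (None \in S'); case: (Some None \in S') => // /(_ isT isT).
- by move=> [[v|]|] //=; rewrite !inE //; apply: blackS.
- by move=> [[v|]|] //=; rewrite !inE //; apply: redS.
Qed.

Lemma black_not_red_leaf (G : cgraph) (u : G) (S : {set G}) :
  colour u = Red -> black_not_red_maximum S ->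
  black_not_red_maximum (lift_set true S : {set add_pendant u Black}).
Proof.
move=> redu [[indS maxS] blackS redS]; split.
- split; first by apply: independent_lift => // _; apply: redS.
  move=> S' indS'; rewrite card_lift_set card_option_set leq_add ?leq_b1 //.
  exact/maxS/independent_restrict.
- by move=> [v|] //=; rewrite !inE //; apply: blackS.
- by move=> [v|] //=; rewrite !inE //; apply: redS.
Qed.

Lemma black_not_red_iso (G H : cgraph) (S : {set G}) :
  cgraph_iso G H -> black_not_red_maximum S ->
  exists S' : {set H}, black_not_red_maximum S'.
Proof.
move=> [f [[g fK gK] edge_f colour_f]] [[indS maxS] blackS redS].
have edge_g x y : edge (g x) (g y) = edge x y by rewrite -edge_f !gK.
have colour_g x : colour (g x) = colour x by rewrite -colour_f gK.
exists (g @^-1: S); split.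
- split=> [x y|S' indS']; first by rewrite !inE -edge_g; apply: indS.
  (* Both sizes are moved to [G], where [maxS] compares [S] with the preimage of [S'] under [f]. *)
  rewrite (on_card_preimset (onW_bij _ (Bijective gK fK))).
  rewrite -(on_card_preimset (R := mem S') (onW_bij _ (Bijective fK gK))).
  by apply: maxS => x y; rewrite !inE -edge_f; apply: indS'.
- by move=> v; rewrite inE -colour_g; apply: blackS.
- by move=> v; rewrite inE -colour_g; apply: redS.
Qed.

Theorem theorem4p3 (G : cgraph) (HG : constructed G) :
  exists S : {set G},
    maximum_independent S /\ forall v : G, colour v = Black -> v \in S.
Proof.
suff [S [maxS blackS _]] : exists S : {set G}, black_not_red_maximum S by exists S.
elim: HG => [n n_gt2 _|{}G u _ [S HS]|{}G u _ [S HS] redu|{}G H _ [S HS] isoGH].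
(* All vertices are blue, so both colour conditions hold vacuously. *)
- by have [S maxS] := maximum_independent_exists (blue_cycle n_gt2); exists S.
- by eexists; apply: black_not_red_path HS.
- by eexists; apply: black_not_red_leaf HS.
- exact: black_not_red_iso HS.
Qed.
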